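(* Given a kinematic triangle $\triangle abc$ and events $a',b',c'$ such that $[a\;b'\;c]$, $[b\;c'\;a]$ and $[c\;a'\;b]$, there is no path which contains $a'$, $b'$ and $c'$.
   Context: Let $\mathcal E$ be a set, whose elements are called events; let $\mathcal P$ be a set of subsets of $\mathcal E$, whose elements are called paths; and let $[\,\cdot\;\cdot\;\cdot\,]$ be a ternary relation (betweenness) on $\mathcal E$. A finite chain is a sequence $(q_0,\dots,q_n)$ of events, $n\ge1$, such that: if $n=1$, then $q_0\ne q_1$ and some path contains both; if $n\ge2$, then $[q_i\;q_j\;q_k]$ for all $0\le i<j<k\le n$. The following axioms are assumed. (I1) $\mathcal E\neq\emptyset$. (I2) For distinct events $a,b$ there are paths $R\ni a$, $S\ni b$ with $R\cap S\ne\emptyset$. (I3) For any two distinct events there is at most one path containing both. (O1) If $[a\;b\;c]$ then some path contains $a,b,c$. (O2) $[a\;b\;c]\Rightarrow[c\;b\;a]$. (O3) $[a\;b\;c]\Rightarrow a\neq c$. (O4) $[a\;b\;c]$ and $[b\;c\;d]$ imply $[a\;b\;d]$ (no distinctness of $a,d$ is assumed). (O5) If $a,b,c$ are distinct events of one path, then $[a\;b\;c]$ or $[b\;c\;a]$ or $[c\;a\;b]$. (O6) If $Q,R,S$ are distinct paths, $T$ is a path, $a\in Q\cap R$, $b\in Q\cap S$, $c\in R\cap S$, and there are $d\in S$ with $[b\;c\;d]$ and $e\in R$ with $[c\;e\;a]$ and $d,e\in T$, then there is $f\in T\cap Q$ belonging to a finite chain with first event $a$ and last event $b$, where $a,f,b$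 are distinct. A kinematic triangle $\triangle abc$ is a set of three distinct events $\{a,b,c\}$ such that each pair of these events belongs to one of three distinct paths. *)

(* Defs.v *)
From mathcomp Require Import all_boot.
From mathcomp Require Import classical_sets.

Set Implicit Arguments.
Unset Strict Implicit.
Unset Printing Implicit Defensive.

Local Open Scope classical_set_scope.

(* The set of events is the type [E], [paths] is a set of subsets of [E], and
   [btw a b c] is the betweenness relation [a b c]. *)

(* A chain (q_0, ..., q_n) is a family indexed by {0, ..., n} = 'I_n.+1. *)
Definition finite_chain (E : Type) (paths : set (set E))
    (btw : E -> E -> E -> Prop) (n : nat) (q : 'I_n.+1 -> E) : Prop :=
  [/\ 1 <= n,
      n = 1 -> q ord0 <> q ord_max /\
               exists Q, [/\ paths Q, Q (q ord0) & Q (q ord_max)]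
    & 2 <= n -> forall i j k : 'I_n.+1, i < j -> j < k ->
                  btw (q i) (q j) (q k)].

Record spacetime_axioms (E : Type) (paths : set (set E))
    (btw : E -> E -> E -> Prop) : Prop := SpacetimeAxioms {
  axI1 : [set: E] !=set0;
  axI2 : forall a b : E, a <> b ->
    exists R S, [/\ paths R, paths S, R a, S b & R `&` S !=set0];
  axI3 : forall a b : E, a <> b -> forall Q R : set E, paths Q -> paths R ->
    Q a -> Q b -> R a -> R b -> Q = R;
  axO1 : forall a b c : E, btw a b c ->
    exists Q, [/\ paths Q, Q a, Q b & Q c];
  axO2 : forall a b c : E, btw a b c -> btw c b a;
  axO3 : forall a b c : E, btw a b c -> a <> c;
  axO4 : forall a b c d : E, btw a b c -> btw b c d -> btw a b d;
  axO5 : forall (Q : set E) (a b c : E), paths Q -> Q a -> Q b -> Q c ->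
    a <> b -> a <> c -> b <> c ->
    [\/ btw a b c, btw b c a | btw c a b];
  axO6 : forall (Q R S T : set E) (a b c : E),
    paths Q -> paths R -> paths S -> Q <> R -> Q <> S -> R <> S -> paths T ->
    (Q `&` R) a -> (Q `&` S) b -> (R `&` S) c ->
    (exists d e, [/\ S d, btw b c d, R e, btw c e a & T d /\ T e]) ->
    exists f, [/\ (T `&` Q) f,
      exists (n : nat) (q : 'I_n.+1 -> E),
        [/\ finite_chain paths btw q, q ord0 = a, q ord_max = b
          & exists i, q i = f]
      & [/\ a <> f, f <> b & a <> b]]
}.

Definition kinematic_triangle (E : Type) (paths : set (set E))
    (a b c : E) : Prop :=
  [/\ a <> b, a <> c, b <> c
    & exists Q R S : set E,
        [/\ [/\ paths Q, paths R & paths S],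
            [/\ Q <> R, Q <> S & R <> S],
            Q a /\ Q b,
            R a /\ R c
          & S b /\ S c]].

(* Main.v *)
Require Import Defs.
From mathcomp Require Import all_boot.
From mathcomp Require Import boolp classical_sets.

(** Let T contain a', b', c'.  These events are distinct, so by O5 and cyclic
    symmetry one may assume [a' b' c'].  The path ca meets the side a'c' of the
    triangle b a' c' in b', and meets the prolongation of the side ba' in c, so
    by O6 it meets bc' strictly between b and c'.  But ca meets the path ab only
    in a, whence [b a c'], which contradicts [b c' a]. *)

Section Betweenness.

Context {E : Type} {paths : set (set E)} {btw : E -> E -> E -> Prop}.
Context (ax : spacetime_axioms paths btw).

Lemma btw_cycleF {a b c : E} : btw a b c -> btw b c a -> False.
Proof. by move=> abc bca; case: (axO3 ax (axO4 ax abc bca)). Qed.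

(** O3 separates only the outer events; if [a = b], then O4 joins [btw c a a] and [btw a a c] into
    [btw c a c], which O3 excludes. *)
Lemma btw_neq12 {a b c : E} : btw a b c -> a <> b.
Proof.
move=> abc eq_ab; rewrite -eq_ab in abc.
by case: (axO3 ax (axO4 ax (axO2 ax abc) abc)).
Qed.

Lemma btw_neq23 {a b c : E} : btw a b c -> b <> c.
Proof. by move=> /(axO2 ax) /btw_neq12 /nesym. Qed.

Lemma btw_mem (Q : set E) {a b c : E} :
  paths Q -> Q a -> Q c -> btw a b c -> Q b.
Proof.
move=> pQ Qa Qc abc; have [R [pR Ra Rb Rc]] := axO1 ax abc.
by rewrite (axI3 ax (axO3 ax abc) pQ pR Qa Qc Ra Rc).
Qed.

Lemma paths_meet_eq (Q R : set E) (x y : E) :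
  paths Q -> paths R -> Q <> R -> Q x -> R x -> Q y -> R y -> x = y.
Proof.
move=> pQ pR neqQR Qx Rx Qy Ry; apply: contrapT => neq_xy.
by apply: neqQR; exact: (axI3 ax neq_xy).
Qed.

(** Turns the chain supplied by O6 into a betweenness: an event other than both ends has its index
    strictly between [0] and [n], which forces [n >= 2]. *)
Lemma finite_chain_btw (n : nat) (q : 'I_n.+1 -> E) (i : 'I_n.+1) :
  finite_chain paths btw q -> q ord0 <> q i -> q i <> q ord_max ->
  btw (q ord0) (q i) (q ord_max).
Proof.
move=> [_ _ chain] neq0 neqn.
have i_gt0 : 0 < i.
  by rewrite lt0n; apply/eqP => i0; apply: neq0; congr q; exact/esym/val_inj.
have i_ltn : i < n.
  rewrite ltn_neqAle -ltnS ltn_ord andbT; apply/eqP => i_n.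
  by apply: neqn; congr q; exact: val_inj.
by apply: chain => //; exact: leq_ltn_trans i_gt0 i_ltn.
Qed.

Lemma ordered_transversalF (A B C T : set E) (a b c a' b' c' : E) :
  paths A -> paths B -> paths C -> paths T ->
  A <> B -> A <> C -> B <> C ->
  B a -> C a -> A b -> C b -> A c -> B c ->
  btw a b' c -> btw b c' a -> btw c a' b ->
  T a' -> T b' -> T c' -> btw a' b' c' -> False.
Proof.
move=> pA pB pC pT neqAB neqAC neqBC Ba Ca Ab Cb Ac Bc.
move=> hb' hc' ha' Ta' Tb' Tc' ord.
have Bb' := btw_mem B pB Ba Bc hb'.
have Cc' := btw_mem C pC Cb Ca hc'.
have Aa' := btw_mem A pA Ac Ab ha'.
(* Otherwise [a'] would be [b], the common event of [A] and [C]. *)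
have neqCT : C <> T.
  move=> eqCT; rewrite -eqCT in Ta'.
  by apply: (btw_neq23 ha'); exact: (paths_meet_eq A C).
have neqTA : T <> A.
  move=> eqTA; rewrite eqTA in Tb'.
  by apply: (btw_neq23 hb'); exact: (paths_meet_eq A B).
(* O6 for the triangle [c'], [b], [a'] with sides [C], [T], [A], cut by [B]: the witnesses are [c],
   beyond [a'] on [A], and [b'], between [a'] and [c'] on [T]. *)
have [|f [[Bf Cf] [n [q [chain q0 qn [i qi]]]] [neqf nefb _]]] :=
  axO6 ax (T := B) (a := c') (b := b) (c := a')
    pC pT pA neqCT (nesym neqAC) neqTA pB
    (conj Cc' Tc') (conj Cb Ab) (conj Ta' Aa').
  by exists c, b'; split=> //; exact: (axO2 ax).
have fa : f = a by exact: (paths_meet_eq B C).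
have c'ab : btw c' a b.
  rewrite -fa -qi -q0 -qn; apply: finite_chain_btw => //.
  - by rewrite q0 qi.
  - by rewrite qi qn.
exact: btw_cycleF hc' c'ab.
Qed.

End Betweenness.

Theorem theorem8 (E : Type) (paths : set (set E)) (btw : E -> E -> E -> Prop)
    (ax : spacetime_axioms paths btw)
    (a b c : E) (tri : kinematic_triangle paths a b c)
    (a' b' c' : E)
    (hb' : btw a b' c) (hc' : btw b c' a) (ha' : btw c a' b) :
  ~ exists T : set E, [/\ paths T, T a', T b' & T c'].
Proof.
case=> T [pT Ta' Tb' Tc'].
(* Each path is named after the vertex opposite to it. *)
case: tri => _ _ _ [C [B [A]]].
case=> [[pC pB pA] [neqCB neqCA neqBA] [Ca Cb] [Ba Bc] [Ab Ac]].
have Bb' := btw_mem ax B pB Ba Bc hb'.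
have Cc' := btw_mem ax C pC Cb Ca hc'.
have Aa' := btw_mem ax A pA Ac Ab ha'.
(* Two coinciding primed events would be the vertex shared by their two sides, from which
   betweenness separates them. *)
have neqa'b' : a' <> b'.
  move=> e; rewrite -e in Bb'; apply: (btw_neq12 ax ha').
  exact: (paths_meet_eq ax A B _ _ pA pB (nesym neqBA)).
have neqa'c' : a' <> c'.
  move=> e; rewrite -e in Cc'; apply: (btw_neq23 ax ha').
  exact: (paths_meet_eq ax A C _ _ pA pC (nesym neqCA)).
have neqb'c' : b' <> c'.
  move=> e; rewrite -e in Cc'; apply: (btw_neq12 ax hb').
  exact: (paths_meet_eq ax B C _ _ pB pC (nesym neqCB)).
(* The three orders in O5 are cyclic shifts of one another, so each is settled by rotating the
   labels of the triangle. *)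
case: (axO5 ax pT Ta' Tb' Tc' neqa'b' neqa'c' neqb'c') => ord.
- exact: (ordered_transversalF ax A B C T a b c a' b' c' pA pB pC pT
            (nesym neqBA) (nesym neqCA) (nesym neqCB)).
- exact: (ordered_transversalF ax B C A T b c a b' c' a' pB pC pA pT
            (nesym neqCB) neqBA neqCA).
- exact: (ordered_transversalF ax C A B T c a b c' a' b' pC pA pB pT
            neqCA neqCB (nesym neqBA)).
Qed.
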